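(* Let $G$ be a group and $N$ a normal subgroup such that $\Gamma=G/N$ is a finitely generated abelian group. Assume the comparison map $c^2_G\colon\mathrm{H}^2_b(G)\to\mathrm{H}^2(G)$ is surjective. Let $p\colon G\to\Gamma$ be the quotient map and $\mathcal{H}$ the image of $\mathrm{H}^1(p)\colon\mathrm{H}^1(\Gamma)\to\mathrm{H}^1(G)$. Then $$\dim_{\mathbb{R}}\mathrm{W}(G,N)=\dim_{\mathbb{R}}\operatorname{Im}(\smile\colon\mathcal{H}\otimes\mathcal{H}\to\mathrm{H}^2(G)),$$ where $\smile$ is the cup product.
   Context: Cohomology and bounded cohomology with trivial real coefficients; $c^2_G$ is induced by inclusion of bounded cochains into all cochains. $\mathrm{Q}(N)^G$: homogeneous quasimorphisms on $N$ invariant under $G$-conjugation; $\mathrm{H}^1(N)^G$: $G$-invariant homomorphisms $N\to\mathbb{R}$; $\mathrm{Q}(G)$: homogeneous quasimorphisms on $G$; $\mathrm{W}(G,N)=\mathrm{Q}(N)^G/(\mathrm{H}^1(N)^G+\{\psi|_N:\psi\in\mathrm{Q}(G)\})$. *)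

(* Defs.v *)
From HB Require Import structures.
From mathcomp Require Import all_boot all_order all_algebra.
From mathcomp Require Import reals.
Set Implicit Arguments. Unset Strict Implicit. Unset Printing Implicit Defensive.
Import Order.TTheory GRing.Theory Num.Theory.

Section Defs.
Variables (R : realType) (G : groupType).
Local Open Scope ring_scope.

Definition zpow (x : G) (z : int) : G :=
  match z with Posz n => (x ^+ n)%g | Negz n => ((x ^+ n.+1)^-1)%g end.

Definition normal_subgroup (N : G -> Prop) : Prop :=
  [/\ N 1%g, (forall x y, N x -> N y -> N (x * y)%g),
      (forall x, N x -> N (x^-1)%g) & (forall x g, N x -> N (x ^ g)%g)].

Definition quotient_abelian (N : G -> Prop) : Prop :=
  forall x y, N [~ x, y]%g.

Definition word_eval k (gen : 'I_k -> G) (w : seq ('I_k * bool)) : G :=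
  foldr (fun l acc => ((if l.2 then gen l.1 else (gen l.1)^-1) * acc)%g) 1%g w.

Definition quotient_fin_gen (N : G -> Prop) : Prop :=
  exists k (gen : 'I_k -> G), forall x : G,
    exists w, N (x * (word_eval gen w)^-1)%g.

(* Inhomogeneous (bar) cochains with trivial real coefficients:
   1-cochains G -> R, 2-cochains G * G -> R. *)
Definition d1 (u : G -> R) : G * G -> R :=
  fun p => u p.2 - u (p.1 * p.2)%g + u p.1.

Definition cocycle2 (c : G * G -> R) : Prop :=
  forall x y z, c (y, z) - c ((x * y)%g, z) + c (x, (y * z)%g) - c (x, y) = 0.

Definition coboundary2 (c : G * G -> R) : Prop :=
  exists u : G -> R, forall p, c p = d1 u p.

Definition bounded2 (c : G * G -> R) : Prop :=
  exists M : R, forall p, `|c p| <= M.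

(* The comparison map c^2_G : H^2_b(G) -> H^2(G) is surjective: every
   2-cocycle is cohomologous (in ordinary cohomology) to a bounded 2-cocycle
   (bounded cocycles represent the classes of H^2_b(G)). *)
Definition comparison2_surjective : Prop :=
  forall c : G * G -> R, cocycle2 c ->
    exists (b : G * G -> R) (u : G -> R),
      cocycle2 b /\ bounded2 b /\ forall p, c p = b p + d1 u p.

(* H^1(G) = Hom(G, R). *)
Definition hom (f : G -> R) : Prop := forall x y, f (x * y)%g = f x + f y.

(* calH = image of H^1(p) : H^1(G/N) -> H^1(G): the homomorphisms G -> R
   factoring through p : G -> G/N, i.e. vanishing on N. *)
Definition calH (N : G -> Prop) (f : G -> R) : Prop :=
  hom f /\ forall n, N n -> f n = 0.

Definition cup (f g : G -> R) : G * G -> R := fun p => f p.1 * g p.2.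

(* 2-cochains representing elements of Im(cup : calH (x) calH -> H^2(G)):
   finite sums of cups of elements of calH, up to coboundaries. *)
Definition cup_image (N : G -> Prop) (c : G * G -> R) : Prop :=
  exists k (f g : 'I_k -> G -> R) (u : G -> R),
    (forall i, calH N (f i)) /\ (forall i, calH N (g i)) /\
    forall p, c p = \sum_(i < k) cup (f i) (g i) p + d1 u p.

(* Homogeneous quasimorphisms on the subgroup H (functions are on G, only
   their values on H matter). *)
Definition homog_qm_on (H : G -> Prop) (psi : G -> R) : Prop :=
  (exists D : R, forall x y, H x -> H y ->
      `|psi (x * y)%g - psi x - psi y| <= D) /\
  (forall x (z : int), H x -> psi (zpow x z) = z%:~R * psi x).

Definition G_invariant_on (N : G -> Prop) (psi : G -> R) : Prop :=
  forall g x, N x -> psi (x ^ g)%g = psi x.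

Definition QNG (N : G -> Prop) (psi : G -> R) : Prop :=
  homog_qm_on N psi /\ G_invariant_on N psi.

Definition H1NG (N : G -> Prop) (h : G -> R) : Prop :=
  (forall x y, N x -> N y -> h (x * y)%g = h x + h y) /\ G_invariant_on N h.

Definition W_den (N : G -> Prop) (psi : G -> R) : Prop :=
  exists h phi : G -> R, H1NG N h /\ homog_qm_on (fun _ => True) phi /\
    forall x, N x -> psi x = h x + phi x.

End Defs.

(* dim_R (A / S) = d, for R-subspaces S <= A of the function space X -> R:
   there are d elements of A whose classes form a basis of A / S. *)
Definition quot_dim (R : realType) (X : Type) (A S : (X -> R) -> Prop) (d : nat)
  : Prop :=
  exists q : 'I_d -> X -> R,
    (forall i, A (q i)) /\
    (forall a : 'I_d -> R,
        S (fun x => \sum_(i < d) a i * q i x)%R -> forall i, a i = 0%R) /\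
    (forall f, A f -> exists a : 'I_d -> R,
        S (fun x => f x - \sum_(i < d) a i * q i x)%R).

(* Main.v *)
From Pilot Require Import Defs.
From HB Require Import structures.
From mathcomp Require Import all_boot all_order all_algebra.
From mathcomp Require Import reals.
From mathcomp Require Import boolp classical_sets ring lra.
Set Implicit Arguments. Unset Strict Implicit. Unset Printing Implicit Defensive.
Import Order.TTheory GRing.Theory Num.Theory Pilot.Defs.
Local Open Scope ring_scope.

(** For [psi] in [Q(N)^G] the map [(x, y) |-> psi [x, y]] on [G] is additive in
each variable up to a bounded error, and bounded when [x] or [y] lies in [N];
homogenizing, it stays at bounded distance from a unique alternating bilinear
form [b] on the abelian group [G/N].  Since [f(x) g(y) + f(y) g(x)] is the
coboundary of [- f g], every class in the image of the cup product is
represented by such a form, and it suffices to see that [psi |-> [b]] maps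
[Q(N)^G] onto these classes with kernel [H^1(N)^G + Q(G)].

Onto: if [b] is a bounded cocycle plus [d u], then the homogenization of [u] on
[N] is an invariant quasimorphism whose form is [- 2 b].  Kernel: adjoining the
generators of [G/N] one at a time, [psi] extends, up to bounded error, to a
function [u] on [G] with [u(xy) - u(x) - u(y) - b(x, y)/2] bounded.  The error is
proportional to the defect of [psi].  Hence [b = 0] makes [psi] extendable to
[G], while for a homomorphism [psi] (defect zero) [b = - 2 d u] exactly. *)

(** * Quasi-additive functions on the integers *)

Section RealLemmas.
Variable R : realType.
Implicit Types (D : R) (f : int -> R).

Lemma norm_le D (e : R) : `|e| <= D -> - D <= e /\ e <= D.
Proof. by rewrite ler_norml => /andP. Qed.

Lemma bounded_multiples_eq0 (C e : R) :
  (forall n : nat, `|n%:R * e| <= C) -> e = 0.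
Proof.
move=> h; apply/eqP/negP => /negP e0.
have := h (Num.truncn (C / `|e|)).+1.
rewrite normrM normr_nat leNgt -ltr_pdivrMr ?normr_gt0 //.
by rewrite truncnS_gt.
Qed.

Lemma quasiadd_ge0 f D : (forall s t, `|f (s + t) - f s - f t| <= D) -> 0 <= D.
Proof. by move=> /(_ 0 0); apply: le_trans. Qed.

(** Each summand costs one defect; the extra one pays for [f 0], known only to lie within [D] of
    zero. *)
Lemma quasiadd_mulrn f D (m : int) (n : nat) :
  (forall s t, `|f (s + t) - f s - f t| <= D) ->
  `|f (m * n%:Z) - n%:R * f m| <= n.+1%:R * D.
Proof.
move=> h; elim: n => [|n IH].
  rewrite mulr0 mul0r subr0 mul1r.
  have /norm_le[h1 h2] := h 0 0.
  by rewrite ler_norml; move: h1 h2; rewrite addr0; lra.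
have -> : m * n.+1%:Z = m * n%:Z + m by rewrite -addn1 PoszD mulrDr mulr1.
have /norm_le[h1 h2] := h (m * n%:Z) m; move/norm_le: IH => [h3 h4].
rewrite ler_norml !mulrSr; move: h3 h4; rewrite !mulrSr; lra.
Qed.

(** The slope is the limit of [f n / n], taken as a supremum: comparing two estimates of [f (m * n)]
    shows that no lower bound [(f n - 2 * D) / n] exceeds an upper bound [(f m + 2 * D) / m]. *)
Lemma quasiadd_slope f D : (forall s t, `|f (s + t) - f s - f t| <= D) ->
  exists la : R, forall t, `|f t - la * t%:~R| <= 4 * D.
Proof.
move=> h; have D0 := quasiadd_ge0 h.
pose E : set R := fun r => exists n : nat, r = (f n.+1%:Z - 2 * D) / n.+1%:R.
have key (m n : nat) :
    (f n.+1%:Z - 2 * D) / n.+1%:R <= (f m.+1%:Z + 2 * D) / m.+1%:R.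
  rewrite ler_pdivrMr ?ltr0n // mulrAC ler_pdivlMr ?ltr0n //.
  have /norm_le[h1 _] := quasiadd_mulrn n.+1%:Z m.+1 h.
  have /norm_le[_ h2] := quasiadd_mulrn m.+1%:Z n.+1 h.
  move: h1 h2; rewrite [n.+1%:Z * _]mulrC.
  have a1 : 1 <= m.+1%:R :> R by rewrite ler1n.
  have a2 : 1 <= n.+1%:R :> R by rewrite ler1n.
  rewrite -[m.+2%:R]natr1 -[n.+2%:R]natr1; nra.
have E0 : (E !=set0)%classic by exists ((f 1 - 2 * D) / 1); exists 0%N.
have Eub : has_ubound E.
  by exists ((f 1 + 2 * D) / 1) => _ [n ->]; exact: (key 0%N n).
have hpos (n : nat) : `|f n.+1%:Z - sup E * n.+1%:R| <= 2 * D.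
  have l1 : (f n.+1%:Z - 2 * D) / n.+1%:R <= sup E.
    by apply: (ub_le_sup Eub); exists n.
  have l2 : sup E <= (f n.+1%:Z + 2 * D) / n.+1%:R.
    by apply: ge_sup => // _ [m ->]; exact: key.
  by move: l1 l2; rewrite ler_pdivrMr ?ltr0n // ler_pdivlMr ?ltr0n // ler_norml; lra.
have f0 : `|f 0| <= D.
  have /norm_le[h1 h2] := h 0 0.
  by rewrite ler_norml; move: h1 h2; rewrite addr0; lra.
exists (sup E) => -[[|n]|n].
- by rewrite mulr0 subr0; apply: le_trans f0 _; lra.
- by apply: le_trans (hpos n) _; lra.
(* At a negative argument the error is [2 * D] from its opposite, plus one defect and the size of
   [f 0]. *)
have /norm_le[h1 h2] := hpos n; have /norm_le[h3 h4] := h n.+1%:Z (Negz n).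
move/norm_le: f0 => [h5 h6]; move: h3 h4; rewrite NegzE subrr => h3 h4.
by rewrite mulrNz ler_norml; move: h1 h2 h3 h4; rewrite -pmulrn; lra.
Qed.
End RealLemmas.

(** * Integer powers in a group *)

Section Zpow.
Variable G : groupType.
Implicit Types (x y g : G) (s t : int).

(** Exponents written as differences of natural numbers spare [zpowD] a case analysis on signs. *)
Lemma zpow_subn x (m n : nat) : zpow x (m%:Z - n%:Z) = (x ^+ m * (x ^+ n)^-1)%g.
Proof.
have [le_nm|lt_mn] := leqP n m.
  by rewrite subzn //= -{2}(subnK le_nm) expgnDr mulgK.
rewrite -opprB subzn ?(ltnW lt_mn) //.
have [k ek] : exists k, (n - m = k.+1)%N.
  by exists (n - m).-1; rewrite prednK // subn_gt0.
rewrite ek -NegzE /= -ek -[in RHS](subnK (ltnW lt_mn)) expgnDr.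
by rewrite invgM mulgA mulgV mul1g.
Qed.

Lemma intE_subn t : exists m n : nat, t = m%:Z - n%:Z.
Proof.
by case: t => n; [exists n, 0%N; rewrite subr0|exists 0%N, n.+1; rewrite sub0r NegzE].
Qed.

Lemma commute_expgV x (m n : nat) :
  ((x ^+ n)^-1 * x ^+ m)%g = (x ^+ m * (x ^+ n)^-1)%g.
Proof. by apply/esym/commuteV/commuteX2/commute_refl. Qed.

Lemma zpowD x s t : zpow x (s + t) = (zpow x s * zpow x t)%g.
Proof.
have [a [b ->]] := intE_subn s; have [c [d ->]] := intE_subn t.
rewrite addrACA -opprD -!PoszD !zpow_subn !expgnDr invgM.
rewrite -!mulgA; congr (_ * _)%g; rewrite !mulgA.
rewrite -!mulgA [RHS]mulgA commute_expgV -!mulgA; congr (_ * _)%g.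
by rewrite -!invgM -!expgnDr addnC.
Qed.

Lemma zpow0 x : zpow x 0 = 1%g. Proof. by []. Qed.

Lemma zpow1 x : zpow x 1 = x. Proof. by []. Qed.

Lemma zpowN x t : zpow x (- t) = ((zpow x t)^-1)%g.
Proof. by apply/esym/mulg1_eq; rewrite -zpowD subrr. Qed.

Lemma zpowM x s t : zpow x (s * t) = zpow (zpow x s) t.
Proof.
have pos (n : nat) : zpow x (s * n%:Z) = zpow (zpow x s) n%:Z.
  elim: n => [|n IH]; first by rewrite mulr0.
  by rewrite -addn1 PoszD mulrDr !zpowD IH mulr1.
by case: t => n //; rewrite NegzE mulrN !zpowN pos.
Qed.

Lemma conjg_zpow x g t : (zpow x t ^ g = zpow (x ^ g) t)%g.
Proof. by case: t => n; rewrite /= ?conjVg conjXg. Qed.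

(** This identity and the next make [psi [~ x, y]] additive in each variable up to the defect of an
    invariant [psi]. *)
Lemma commMgE x y g : ([~ x * y, g] = [~ x, g] ^ y * [~ y, g])%g.
Proof.
rewrite !commgEl !conjgE !invgM -!mulgA.
by rewrite !(mulKg, mulVKg, mulgK, mulgVK).
Qed.

Lemma commgME x y g : ([~ x, y * g] = [~ x, g] * [~ x, y] ^ g)%g.
Proof.
rewrite !commgEl !conjgE !invgM -!mulgA.
by rewrite !(mulKg, mulVKg, mulgK, mulgVK).
Qed.

End Zpow.

(** * Homogenization along cyclic subgroups *)

Section Homogenization.
Variables (R : realType) (G : groupType).
Implicit Types (H : G -> Prop) (u v f : G -> R) (D C : R).

Lemma slope_uniq (f : int -> R) (a b C1 C2 : R) :
  (forall t, `|f t - a * t%:~R| <= C1) -> (forall t, `|f t - b * t%:~R| <= C2) ->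
  a = b.
Proof.
move=> ha hb; apply/eqP; rewrite -subr_eq0; apply/eqP.
apply: (@bounded_multiples_eq0 _ (C1 + C2)) => n.
have /norm_le[h1 h2] := ha n; have /norm_le[h3 h4] := hb n.
by move: h1 h2 h3 h4; rewrite ler_norml -!pmulrn; lra.
Qed.

Lemma hom1 f : hom f -> f 1%g = 0.
Proof. by move=> hf; have := hf 1%g 1%g; rewrite mul1g; lra. Qed.

Lemma homV f x : hom f -> f (x^-1)%g = - f x.
Proof. by move=> hf; have := hf x (x^-1)%g; rewrite mulgV hom1 //; lra. Qed.

Lemma hom_zpow f x (t : int) : hom f -> f (zpow x t) = t%:~R * f x.
Proof.
move=> hf; have pos (n : nat) : f (x ^+ n)%g = n%:R * f x.
  elim: n => [|n IH]; first by rewrite expg0 hom1 // mul0r.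
  by rewrite expgS hf IH mulrSr; ring.
case: t => n; first by rewrite /= pos.
by rewrite [zpow _ _]/= homV // pos NegzE mulrNz mulNr.
Qed.

(** [v x] is the slope of [t |-> u (zpow x t)], and uniqueness of slopes makes it homogeneous.
    Near-additivity is asked only along powers of one element, where an alternating form vanishes,
    so [u] may be a quasimorphism twisted by such a form. *)
Lemma homogenize H u D :
  (forall x t, H x -> H (zpow x t)) ->
  (forall x s t, H x -> `|u (zpow x (s + t)) - u (zpow x s) - u (zpow x t)| <= D) ->
  exists v : G -> R, forall x, H x ->
    `|v x - u x| <= 4 * D /\ forall t, v (zpow x t) = t%:~R * v x.
Proof.
move=> HX hu.
have [v hv] : {v : G -> R & forall x, H x ->
    forall t, `|u (zpow x t) - v x * t%:~R| <= 4 * D}.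
  apply: (@choice _ _ (fun x la => H x ->
    forall t, `|u (zpow x t) - la * t%:~R| <= 4 * D)) => x.
   have [Hx|nHx] := pselect (H x); last by exists 0.
  have [la hla] := quasiadd_slope (fun s t => hu x s t Hx).
  by exists la.
exists v => x Hx; split.
  by have := hv x Hx 1; rewrite zpow1 mulr1 distrC.
move=> t; apply: (@slope_uniq (fun s => u (zpow x (t * s)))).
  by move=> s; rewrite zpowM; apply: hv; exact: HX.
by move=> s; have := hv x Hx (t * s); rewrite intrM;
  congr (`|_ - _| <= _); ring.
Qed.

Lemma homogeneous_near_eq H v w C :
  (forall x t, H x -> H (zpow x t)) ->
  (forall x t, H x -> v (zpow x t) = t%:~R * v x) ->
  (forall x t, H x -> w (zpow x t) = t%:~R * w x) ->
  (forall x, H x -> `|v x - w x| <= C) ->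
  forall x, H x -> v x = w x.
Proof.
move=> HX hv hw hvw x Hx; apply/eqP; rewrite -subr_eq0; apply/eqP.
apply: (@bounded_multiples_eq0 _ C) => n.
have := hvw _ (HX x n Hx); rewrite hv // hw // -mulrBr.
by rewrite -pmulrn.
Qed.

Lemma homogeneous_bounded_eq0 H v C :
  (forall x t, H x -> H (zpow x t)) ->
  (forall x t, H x -> v (zpow x t) = t%:~R * v x) ->
  (forall x, H x -> `|v x| <= C) -> forall x, H x -> v x = 0.
Proof.
move=> HX hv hvw; apply: (@homogeneous_near_eq _ _ _ C HX hv).
  by move=> x t _; rewrite mulr0.
by move=> x Hx; rewrite subr0; exact: hvw.
Qed.

Definition is_subgroup H := [/\ H 1%g, forall x y, H x -> H y -> H (x * y)%g
  & forall x, H x -> H (x^-1)%g].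

Lemma subgroup_zpow H x t : is_subgroup H -> H x -> H (zpow x t).
Proof.
move=> [H1 HM HV] Hx; have HX (n : nat) : H (x ^+ n)%g.
  by elim: n => [|n IH]; [rewrite expg0|rewrite expgS; apply: HM].
by case: t => n; [exact: HX|apply: HV; exact: HX].
Qed.

End Homogenization.

(** * Alternating forms on the abelian quotient *)

Section AltForm.
Variables (R : realType) (G : groupType) (N : G -> Prop).
Hypotheses (nN : normal_subgroup N) (abN : quotient_abelian N).

(** Alternating bilinear forms on [G/N], kept as functions on [G]. Vanishing on [N] in the second
    variable follows by antisymmetry. *)
Record altform (b : G -> G -> R) : Prop := AltForm {
  altMl : forall z, hom (b^~ z);
  altMr : forall x, hom (b x);
  altxx : forall x, b x x = 0;
  altN : forall n y, N n -> b n y = 0 }.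

Lemma altC b x y : altform b -> b x y = - b y x.
Proof.
move=> [bl br bx _]; have := bx (x * y)%g.
by rewrite bl !br !bx; lra.
Qed.

Lemma altNr b x n : altform b -> N n -> b x n = 0.
Proof. by move=> hb Nn; rewrite altC // (altN hb) // oppr0. Qed.

Lemma altXl b x y t : altform b -> b (zpow x t) y = t%:~R * b x y.
Proof. by move=> hb; rewrite (hom_zpow x t (altMl hb y)). Qed.

Lemma altXr b x y t : altform b -> b x (zpow y t) = t%:~R * b x y.
Proof. by move=> hb; rewrite (hom_zpow y t (altMr hb x)). Qed.

Lemma altform_lin b b' (a : R) : altform b -> altform b' ->
  altform (fun x y => a * b x y + b' x y).
Proof.
move=> [l r d n] [l' r' d' n']; split => [z x y|x y z|x|m y Nm].
- by rewrite l l'; lra.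
- by rewrite r r'; lra.
- by rewrite d d' mulr0 addr0.
- by rewrite n // n' // mulr0 addr0.
Qed.

Lemma altform0 : altform (fun _ _ => 0).
Proof. by split => // ? ? ?; rewrite addr0. Qed.

Lemma altform_bounded_eq0 b (C : R) : altform b -> (forall x y, `|b x y| <= C) ->
  forall x y, b x y = 0.
Proof.
move=> hb hC x y; apply: (@bounded_multiples_eq0 _ C) => n.
by have := hC (zpow x n) y; rewrite altXl // -pmulrn.
Qed.

Lemma normal_subgroup_sub : is_subgroup N.
Proof. by case: nN. Qed.

Let NX x t : N x -> N (zpow x t) := subgroup_zpow t normal_subgroup_sub.

(* (x y)^t = x^t y^t modulo N, and phi vanishes on N. *)
Lemma homogeneous_hom (phi : G -> R) (D : R) :
  (forall x y, `|phi (x * y)%g - phi x - phi y| <= D) ->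
  (forall x t, phi (zpow x t) = t%:~R * phi x) ->
  (forall n, N n -> phi n = 0) -> hom phi.
Proof.
move=> hD hX hN x y.
have cN (t : nat) : N (((x ^+ t * y ^+ t)^-1 * (x * y) ^+ t)%g).
  case: nN => N1 NM NV NJ; elim: t => [|t IH]; first by rewrite !expg0 !mulg1 invg1.
  set a := (x ^+ t)%g; set c := (y ^+ t)%g; set w := ((a * c)^-1 * (x * y) ^+ t)%g in IH.
  have -> : ((x * y) ^+ t.+1 = a * c * w * (x * y))%g.
    by rewrite expgSr /w mulVKg.
  (* The error for [t.+1] is a conjugate commutator times a conjugate of the error [w] for [t]; both
     factors lie in [N]. *)
  have -> : ((x ^+ t.+1 * y ^+ t.+1)^-1 * (a * c * w * (x * y)) =
     [~ c, x] ^ y * w ^ (x * y))%g.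
    rewrite !expgSr -/a -/c commgEl !conjgE !invgM -!mulgA.
    by rewrite !(mulKg, mulVKg, mulgK, mulgVK).
  by apply: NM; apply: NJ.
apply/eqP; rewrite -subr_eq0; apply/eqP.
(* One defect splits off the factor in [N], another splits [x ^+ t * y ^+ t]. *)
apply: (@bounded_multiples_eq0 _ (2 * D)) => t.
have e : ((x * y) ^+ t = x ^+ t * y ^+ t * ((x ^+ t * y ^+ t)^-1 * (x * y) ^+ t))%g.
  by rewrite mulVKg.
have h1 := hX (x * y)%g t; have h2 := hX x t; have h3 := hX y t.
have /norm_le[h4 h5] := hD (x ^+ t * y ^+ t)%g ((x ^+ t * y ^+ t)^-1 * (x * y) ^+ t)%g.
have /norm_le[h6 h7] := hD (x ^+ t)%g (y ^+ t)%g.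
move: h4 h5; rewrite -e (hN _ (cN t)) => h4 h5.
move: h1 h2 h3; rewrite /= -pmulrn => h1 h2 h3.
by rewrite ler_norml; move: h1 h2 h3 h4 h5 h6 h7; lra.
Qed.

(** Homogenizing in the first variable alone suffices. Vanishing on [N], additivity in the second
    variable and alternation hold up to a bounded error, and become exact on replacing the first
    argument by its powers; additivity in the first variable is then [homogeneous_hom]. *)
Lemma QNG_altform psi : QNG N psi -> exists2 b, altform b &
  exists C : R, forall x y, `|psi [~ x, y]%g - b x y| <= C.
Proof.
move=> [[[D hD] hX] hJ].
have [N1 NM NV NJ] := nN.
have psi1 : psi 1%g = 0 by have := hX 1%g 0 N1; rewrite zpow0 mul0r.
have psiV x : N x -> psi (x^-1)%g = - psi x.
  by move=> Nx; have := hX x (-1) Nx; rewrite zpowN zpow1 mulN1r.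
have BMl x y z : `|psi [~ x * y, z]%g - psi [~ x, z]%g - psi [~ y, z]%g| <= D.
  rewrite commMgE -(hJ y [~ x, z]%g) //; apply: hD => //; exact: NJ.
have BMr x y z : `|psi [~ x, y * z]%g - psi [~ x, y]%g - psi [~ x, z]%g| <= D.
  rewrite commgME; have := hD [~ x, z]%g ([~ x, y] ^ z)%g (abN _ _) (NJ _ _ (abN _ _)).
  by rewrite (hJ z [~ x, y]%g) // addrAC.
have BN n y : N n -> `|psi [~ n, y]%g| <= D.
  move=> Nn; have := hD (n^-1)%g (n ^ y)%g (NV _ Nn) (NJ _ _ Nn).
  by rewrite -commgEl hJ // psiV // opprK addrK.
have [v hv] : {v : G -> G -> R & forall y x, `|v y x - psi [~ x, y]%g| <= 4 * D /\
    forall t, v y (zpow x t) = t%:~R * v y x}.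
  apply: (@choice _ _ (fun y w => forall x, `|w x - psi [~ x, y]%g| <= 4 * D /\
    forall t, w (zpow x t) = t%:~R * w x)) => y.
  have [//|x s t _|v hv] := @homogenize R G (fun=> True) (fun x => psi [~ x, y]%g) D.
    by rewrite zpowD; exact: BMl.
  by exists v => x; exact: hv.
have vX y x t : v y (zpow x t) = t%:~R * v y x by case: (hv y x).
have vB y x : - (4 * D) <= v y x - psi [~ x, y]%g /\ v y x - psi [~ x, y]%g <= 4 * D.
  by apply: norm_le; case: (hv y x).
have vN y n : N n -> v y n = 0.
  move: n; apply: (@homogeneous_bounded_eq0 R G N (v y) (5 * D)) => //.
  move=> n Nn; have [h1 h2] := vB y n; have /norm_le[h3 h4] := BN n y Nn.
  by rewrite ler_norml; move: h1 h2 h3 h4; lra.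
have vM y : hom (v y).
  (* Three homogenization errors [4 * D] and one defect [D]. *)
  apply: (@homogeneous_hom _ (13 * D)) => // [x z|]; last exact: vN.
  have [h1 h2] := vB y x; have [h3 h4] := vB y z; have [h5 h6] := vB y (x * z)%g.
  have /norm_le[h7 h8] := BMl x z y.
  by rewrite ler_norml; move: h1 h2 h3 h4 h5 h6 h7 h8; lra.
exists (fun x y => v y x); last first.
  by exists (4 * D) => x y; rewrite distrC; case: (hv y x).
split => //=.
- move=> x y z; apply/eqP; rewrite -subr_eq0; apply/eqP.
  apply: (@bounded_multiples_eq0 _ (13 * D)) => n.
  have [h1 h2] := vB y (zpow x n); have [h3 h4] := vB z (zpow x n).
  have [h5 h6] := vB (y * z)%g (zpow x n).
  have /norm_le[h7 h8] := BMr (zpow x n) y z.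
  move: h1 h2 h3 h4 h5 h6 h7 h8; rewrite !vX -!pmulrn ler_norml; lra.
- move=> x; apply: (@bounded_multiples_eq0 _ (4 * D)) => n.
  have [h1 h2] := vB x (zpow x n); move: h1 h2.
  rewrite vX -pmulrn (_ : [~ zpow x n, x]%g = 1%g) ?psi1.
    by rewrite ler_norml; lra.
  by apply/eqP; rewrite commg1_sym /= commgXg.
- by move=> n y; exact: vN.
Qed.
End AltForm.

(** * Extending from N to G one generator at a time *)

Section Extension.
Variables (R : realType) (G : groupType) (N : G -> Prop).
Hypotheses (nN : normal_subgroup N) (abN : quotient_abelian N).
Variables (b : G -> G -> R) (psi : G -> R).
Hypothesis hb : altform N b.
Implicit Types (H : G -> Prop) (u : G -> R) (D : R).

(** The invariant of the induction on generators. The factor [1/2] fits the second clause: [u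
    [~ x, y]] is near [u (x * y) - u (y * x)], hence near [(b x y - b y x) / 2 = b x y]. *)
Definition twisted_qm D H u :=
  [/\ forall x y, H x -> H y -> `|u (x * y)%g - u x - u y - b x y / 2| <= D,
      forall x y, `|u [~ x, y]%g - b x y| <= D
    & forall n, N n -> `|u n - psi n| <= D].

(** The product of [H] with the cyclic group of [g]. The exponent [a] is not unique when a
    nontrivial power of [g] lies in [H]. *)
Definition adjoin H g : G -> Prop := fun x => exists a : int, H (x * zpow g (- a))%g.

(** Moving [zpow g (- a)] past [y * zpow g (- c)] costs one commutator, which lies in [N]. *)
Lemma adjoin_mulE (x y g : G) (a c : int) :
  (x * y * zpow g (- (a + c)) =
   x * zpow g (- a) * (y * zpow g (- c)) * [~ y * zpow g (- c), zpow g (- a)])%g.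
Proof.
rewrite opprD addrC zpowD !zpowN; set A := zpow g a; set C := zpow g c.
rewrite commgEl !conjgE !invgM !invgK -!mulgA.
by rewrite !(mulKg, mulVKg, mulgK, mulgVK).
Qed.

Lemma adjoin_subgroup H g : is_subgroup H -> (forall n, N n -> H n) ->
  is_subgroup (adjoin H g) /\ (forall x, H x -> adjoin H g x).
Proof.
move=> [H1 HM HV] NH; have sub x : H x -> adjoin H g x.
  by exists 0; rewrite oppr0 zpow0 mulg1.
split=> //; split; first exact: sub.
  move=> x y [a ha] [c hc]; exists (a + c); rewrite adjoin_mulE.
  by apply: (HM); [exact: HM|exact: NH].
move=> x [a ha]; exists (- a); rewrite opprK.
have -> : (x^-1 * zpow g a = (x * zpow g (- a))^-1 *
    [~ (x * zpow g (- a))^-1, zpow g a])%g.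
  rewrite commgEl !conjgE !invgM !invgK zpowN !invgK -!mulgA.
  by rewrite !(mulKg, mulVKg, mulgK, mulgVK).
by apply: (HM); [exact: HV|exact: NH].
Qed.

(** [la] is the value to assign to [g]. If a nonzero power of [g] lies in [H], the homogenization of
    [u] there dictates it; otherwise only [a = 0] matters and [la = 0] will do. *)
Lemma twisted_qm_slope D H u g : is_subgroup H -> twisted_qm D H u ->
  exists la : R, forall a : int, H (zpow g a) ->
    `|u (zpow g a) - la * a%:~R| <= 4 * D.
Proof.
move=> sH [hu _ _].
have HX x t : H x -> H (zpow x t) by exact: subgroup_zpow.
have [x s t Hx|v hv] := @homogenize R G H u D HX.
  have := hu _ _ (HX x s Hx) (HX x t Hx).
  by rewrite zpowD (altXl _ _ _ hb) (altXr _ _ _ hb) (altxx hb) !mulr0 mul0r subr0.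
have [[m [m0 Hm]]|nm] := pselect (exists m : int, m != 0 /\ H (zpow g m)).
  exists (v (zpow g m) / m%:~R) => a Ha.
  have m0' : m%:~R != 0 :> R by rewrite intr_eq0.
  suff <- : v (zpow g a) = v (zpow g m) / m%:~R * a%:~R.
    by rewrite distrC; case: (hv _ Ha).
  apply: (mulIf m0'); rewrite mulrAC divfK //.
  have [_ e1] := hv _ Ha; have [_ e2] := hv _ Hm.
  by rewrite mulrC -e1 -zpowM mulrC zpowM e2 mulrC.
exists 0 => a Ha.
have a0 : a = 0 by apply: contrapT => /eqP a0; apply: nm; exists a.
rewrite {a}a0 zpow0 in Ha *; have [h1 h2] := hv _ Ha.
by have := h2 0; rewrite zpow0 mul0r => e; move: h1; rewrite e mul0r subr0 sub0r normrN.
Qed.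

(** The value at [p * zpow g a], for [p] in [H], is dictated by the twisted relation; a choice of
    exponent for each element turns it into a function, at the price of a bounded error. *)
Lemma twisted_qm_adjoin D H u g : is_subgroup H -> (forall n, N n -> H n) ->
  twisted_qm D H u -> exists u', twisted_qm (8 * D) (adjoin H g) u'.
Proof.
move=> sH NH tu; have [la hla] := twisted_qm_slope g sH tu.
have [H1 HM HV] := sH; have [hu hc hpsi] := tu.
have D0 : 0 <= D by exact: le_trans (hc 1%g 1%g).
(* With [p = x * zpow g (- a)], this is [u p + u (zpow g a) + b p (zpow g a) / 2], where [la * a]
   stands for [u (zpow g a)] and [b p g = b x g]. *)
pose w x (a : int) := u (x * zpow g (- a))%g + la * a%:~R + a%:~R / 2 * b x g.
have bp x a : b (x * zpow g (- a))%g g = b x g.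
  by rewrite (altMl hb) (altXl _ _ _ hb) (altxx hb) mulr0 addr0.
(* up to an error, w x a does not depend on the exponent a chosen for x *)
have indep x a c : H (x * zpow g (- a))%g -> H (x * zpow g (- c))%g ->
    - (5 * D) <= w x a - w x c /\ w x a - w x c <= 5 * D.
  move=> ha hcc; set p := (x * zpow g (- a))%g in ha *.
  have e : (x * zpow g (- c) = p * zpow g (a - c))%g.
    by rewrite /p -mulgA -zpowD addKr.
  have He : H (zpow g (a - c)).
    by rewrite -(mulKg p (zpow g _)) -e; apply: (HM) => //; exact: HV.
  have /norm_le[h1 h2] := hu _ _ ha He; have /norm_le[h3 h4] := hla _ He.
  move: h1 h2 h3 h4; rewrite (altXr _ _ _ hb) bp -e /w -/p intrB; lra.
have [al hal] : {al : G -> int & forall x, adjoin H g x -> H (x * zpow g (- al x))%g}.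
  apply: (@choice _ _ (fun x a => adjoin H g x -> H (x * zpow g (- a))%g)) => x.
  have [[a ha]|nx] := pselect (adjoin H g x); first by exists a.
  by exists 0 => /nx.
(* On [N] the exponent 0 is admissible, and [w n 0 = u n]. *)
have near n : N n -> - (5 * D) <= w n (al n) - u n /\ w n (al n) - u n <= 5 * D.
  move=> Nn; have Hn := NH _ Nn.
  have H0 : H (n * zpow g (- 0))%g by rewrite oppr0 zpow0 mulg1.
  have := indep n (al n) 0 (hal n _) H0; rewrite {2 4}/w oppr0 zpow0 mulg1.
  rewrite mulr0 mul0r mul0r !addr0; apply; exact: (adjoin_subgroup g sH NH).2.
exists (fun x => w x (al x)); split=> [x y Hx Hy|x y|n Nn].
- have Hxy : adjoin H g (x * y)%g.
    by have [[_ M _] _] := adjoin_subgroup g sH NH; apply: M.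
  set a := al x; set c := al y.
  set p := (x * zpow g (- a))%g; set q := (y * zpow g (- c))%g.
  have Hp : H p by exact: hal.
  have Hq : H q by exact: hal.
  have Nr : N [~ q, zpow g (- a)]%g by exact: abN.
  have e : (x * y * zpow g (- (a + c)) = p * q * [~ q, zpow g (- a)])%g.
    exact: adjoin_mulE.
  have Hpqr : H (x * y * zpow g (- (a + c)))%g.
    by rewrite e; apply: (HM); [exact: HM|exact: NH].
  (* The total [8 * D] is [5 * D] for the change of exponent, and [D] each for splitting off the
     commutator, for [u (p * q)], and for [u] at the commutator. *)
  have [h1 h2] := indep _ (al (x * y)%g) (a + c) (hal _ Hxy) Hpqr.
  have /norm_le[h3 h4] := hu _ _ (HM _ _ Hp Hq) (NH _ Nr).
  have /norm_le[h5 h6] := hu _ _ Hp Hq.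
  have /norm_le[h7 h8] := hc q (zpow g (- a)).
  have e1 : b p q = b x y - c%:~R * b x g + a%:~R * b y g.
    rewrite /p /q (altMl hb) !(altMr hb) !(altXl _ _ _ hb) !(altXr _ _ _ hb) (altxx hb).
    by rewrite (altC g y hb) !mulrNz; ring.
  move: h3 h4 h7 h8; rewrite -e (altNr _ hb Nr) (altXr _ _ _ hb) /q bp mulrNz => h3 h4 h7 h8.
  have e2 : w (x * y)%g (a + c) = u (x * y * zpow g (- (a + c)))%g +
      la * (a%:~R + c%:~R) + (a%:~R + c%:~R) / 2 * (b x g + b y g).
    by rewrite /w (altMl hb) intrD.
  have e3 : w x a = u p + la * a%:~R + a%:~R / 2 * b x g by [].
  have e4 : w y c = u q + la * c%:~R + c%:~R / 2 * b y g by [].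
  rewrite ler_norml; move: h1 h2 h3 h4 h5 h6 h7 h8.
  rewrite e1 e2 e3 e4 -/q; lra.
- have [h1 h2] := near _ (abN x y); have /norm_le[h3 h4] := hc x y.
  by rewrite ler_norml; move: h1 h2 h3 h4 D0; lra.
- have [h1 h2] := near _ Nn; have /norm_le[h3 h4] := hpsi _ Nn.
  by rewrite ler_norml; move: h1 h2 h3 h4 D0; lra.
Qed.

Lemma twisted_qm_adjoins (gs : seq G) D H u : is_subgroup H ->
  (forall n, N n -> H n) -> twisted_qm D H u ->
  exists H' u', [/\ is_subgroup H', forall x, H x -> H' x,
    forall g, g \in gs -> H' g & twisted_qm (8 ^+ size gs * D) H' u'].
Proof.
elim: gs D H u => [|g gs IH] D H u sH NH tu.
  by exists H, u; split=> //; rewrite mul1r.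
have [u1 tu1] := twisted_qm_adjoin g sH NH tu.
have [sH1 HH1] := adjoin_subgroup g sH NH.
have [H' [u' [sH' H1H' gsH' tu']]] := IH _ _ _ sH1 (fun n Nn => HH1 n (NH n Nn)) tu1.
exists H', u'; split=> //.
- by move=> x Hx; apply/H1H'/HH1.
- move=> x; rewrite inE => /predU1P[->|]; last exact: gsH'.
  apply: H1H'; exists 1; rewrite zpowN zpow1 mulgV.
  by case: sH.
- by rewrite /= exprSr -mulrA.
Qed.

(** The form [K * D] of the bound serves two purposes: a bounded error in general, and equalities
    when [D = 0]. *)
Lemma quasimorphism_extension D : quotient_fin_gen N ->
  (forall x y, N x -> N y -> `|psi (x * y)%g - psi x - psi y| <= D) ->
  (forall x y, `|psi [~ x, y]%g - b x y| <= D) ->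
  exists (K : R) (u : G -> R),
    (forall x y, `|u (x * y)%g - u x - u y - b x y / 2| <= K * D) /\
    (forall n, N n -> `|u n - psi n| <= K * D).
Proof.
move=> [k [gen hgen]] hpsi hc.
have D0 : 0 <= D by exact: le_trans (hc 1%g 1%g).
(* Since [b] vanishes on [N], the function [psi] itself starts the induction. *)
have tN : twisted_qm D N psi.
  split=> // [x y Nx Ny|n _]; last by rewrite subrr normr0.
  by rewrite (altN hb) // mul0r subr0; exact: hpsi.
have [H [u [[H1 HM HV] NH gH [hu _ hn]]]] :=
  twisted_qm_adjoins [seq gen i | i <- enum 'I_k] (normal_subgroup_sub nN) (fun n Nn => Nn) tN.
have Hgen i : H (gen i) by apply: gH; apply: map_f; rewrite mem_enum.
have HG x : H x.
  have [w Nw] := hgen x; rewrite -(mulgVK (word_eval gen w) x).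
  apply: (HM) _ _ (NH _ Nw) _; elim: w {Nw} => [|[i s] w IH] //=.
  by apply: (HM) => //; case: s => //=; exact: HV.
by exists (8 ^+ size [seq gen i | i <- enum 'I_k]), u; split=> // x y; exact: hu.
Qed.

End Extension.

(** * Dimensions of quotients *)

Section QuotDim.
Variable R : realType.

(** A relation rather than a map, because a quasimorphism corresponds to a cocycle only up to
    coboundaries. *)
Definition linear_rel (X Y : Type) (E : (X -> R) -> (Y -> R) -> Prop) : Prop :=
  E (fun=> 0) (fun=> 0) /\
  forall (a : R) f g f' g', E f f' -> E g g' ->
    E (fun x => a * f x + g x) (fun y => a * f' y + g' y).

Lemma linear_rel_sum (X Y : Type) (E : (X -> R) -> (Y -> R) -> Prop) d q q'
    (a : 'I_d -> R) : linear_rel E -> (forall i, E (q i) (q' i)) ->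
  E (fun x => \sum_(i < d) a i * q i x) (fun y => \sum_(i < d) a i * q' i y).
Proof.
move=> [E0 EL]; elim: d q q' a => [|d IH] q q' a hq.
  rewrite (_ : (fun x => _) = fun=> 0); last by apply: funext => x; rewrite big_ord0.
  by rewrite (_ : (fun y => _) = fun=> 0) //; apply: funext => x; rewrite big_ord0.
rewrite (_ : (fun x => _) = fun x => a ord0 * q ord0 x +
    \sum_(i < d) a (lift ord0 i) * q (lift ord0 i) x); last first.
  by apply: funext => x; rewrite big_ord_recl.
rewrite (_ : (fun y => \sum_(i < d.+1) _) = fun y => a ord0 * q' ord0 y +
    \sum_(i < d) a (lift ord0 i) * q' (lift ord0 i) y); last first.
  by apply: funext => x; rewrite big_ord_recl.
by apply: EL => //; apply: (IH (fun i => q (lift ord0 i)) (fun i => q' (lift ord0 i))).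
Qed.

Lemma ex_dependence d (Y : finType) (q : 'I_d -> Y -> R) : (#|Y| < d)%N ->
  exists2 a : 'I_d -> R, (exists i, a i != 0) & forall y, \sum_(i < d) a i * q i y = 0.
Proof.
move=> ltd; pose M := \matrix_(i < d, j < #|Y|) q i (enum_val j).
have : kermx M != 0.
  rewrite kermx_eq0 /row_free neq_ltn; apply/orP; left.
  exact: leq_ltn_trans (rank_leq_col M) ltd.
move=> /rowV0Pn[v /sub_kermxP vM v0]; exists (fun i => v 0 i).
  by move/rV0Pn: v0.
move=> y; have /rowP/(_ (enum_rank y)) := vM; rewrite !mxE => e.
by apply: etrans e; apply: eq_bigr => i _; rewrite mxE enum_rankK.
Qed.

(** [E] acts as a linear map into the finite-dimensional space [Y -> R] with kernel inside [S].
    Families independent modulo [S] thus have at most [#|Y|] members, and one of maximal size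
    spans. *)
Lemma quot_dim_exists (X : Type) (Y : finType) (A S : (X -> R) -> Prop)
    (E : (X -> R) -> (Y -> R) -> Prop) :
  linear_rel E -> (forall f, A f -> exists v, E f v) ->
  (forall f, E f (fun=> 0) -> S f) ->
  (forall (a : R) f, S f -> S (fun x => a * f x)) ->
  exists d, quot_dim A S d.
Proof.
move=> EL Etot ES SZ.
pose free d := exists q : 'I_d -> X -> R, (forall i, A (q i)) /\
  (forall a : 'I_d -> R, S (fun x => \sum_(i < d) a i * q i x) -> forall i, a i = 0).
pose P d := `[< free d >].
have exP : exists d, P d.
  exists 0%N; apply/asboolP; exists (fun _ _ => 0); split; by [case|move=> a _ []].
have leP d : P d -> (d <= #|Y|)%N.
  move=> /asboolP[q [Aq qfree]]; rewrite leqNgt; apply/negP => ltd.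
  have [q' hq'] : {q' : 'I_d -> Y -> R & forall i, E (q i) (q' i)}.
    by apply: (@choice _ _ (fun i v => E (q i) v)) => i; exact: Etot.
  have [a [i ai] ha] := ex_dependence q' ltd.
  move/eqP: ai; apply; apply: qfree; apply: ES.
  rewrite -(_ : (fun y => \sum_(i < d) a i * q' i y) = fun=> 0); last exact: funext.
  exact: linear_rel_sum.
case: (ex_maxnP exP leP) => d /asboolP[q [Aq qfree]] dmax.
exists d, q; split=> //; split=> // f Af; apply: contrapT => nf.
suff : P d.+1 by move=> /dmax; rewrite ltnn.
apply/asboolP; pose q1 i := if unlift ord0 i is Some j then q j else f.
exists q1; split=> [i|a]; first by rewrite /q1; case: unlift.
rewrite (_ : (fun x => _) = fun x => a ord0 * f x +
    \sum_(i < d) a (lift ord0 i) * q i x); last first.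
  apply: funext => x; rewrite big_ord_recl /q1 unlift_none; congr (_ + _).
  by apply: eq_bigr => i _; rewrite liftK.
move=> Sa; have [a0|a0] := eqVneq (a ord0) 0.
  have Sq : S (fun x => \sum_(i < d) a (lift ord0 i) * q i x).
    by move: Sa; rewrite a0; under eq_fun do rewrite mul0r add0r.
  move=> i; case: (unliftP ord0 i) => [j|] -> //.
  exact: (qfree (fun j => a (lift ord0 j)) Sq).
(* A relation with nonzero coefficient at [f] is solved for [f]. *)
case: nf; exists (fun i => - ((a ord0)^-1 * a (lift ord0 i))).
rewrite (_ : (fun x => _) = fun x => (a ord0)^-1 * (a ord0 * f x +
    \sum_(i < d) a (lift ord0 i) * q i x)); first exact: SZ.
apply: funext => x; rewrite mulrDr mulKf // -sumrN mulr_sumr; congr (_ + _).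
by apply: eq_bigr => i _; rewrite mulNr opprK mulrA.
Qed.

(** The hypotheses make [E] induce an isomorphism of [A / S] with [A' / S'], along which a basis is
    lifted. *)
Lemma quot_dim_transport (X Y : Type) (A S : (X -> R) -> Prop)
    (A' S' : (Y -> R) -> Prop) (E : (X -> R) -> (Y -> R) -> Prop) d :
  linear_rel E ->
  (forall f, A f -> exists2 f', A' f' & E f f') ->
  (forall f', A' f' -> exists2 f, A f & E f f') ->
  (forall f f', E f f' -> S f <-> S' f') ->
  quot_dim A' S' d -> quot_dim A S d.
Proof.
move=> EL Etot Esurj ES [q' [Aq' [q'free q'span]]].
have [q hq] : {q : 'I_d -> X -> R & forall i, A (q i) /\ E (q i) (q' i)}.
  apply: (@choice _ _ (fun i f => A f /\ E f (q' i))) => i.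
  by have [f Af Ef] := Esurj _ (Aq' i); exists f.
have Esum a : E (fun x => \sum_(i < d) a i * q i x) (fun y => \sum_(i < d) a i * q' i y).
  by apply: linear_rel_sum => // i; case: (hq i).
exists q; split=> [i|]; first by case: (hq i).
split=> [a Sa|f Af]; first by apply: q'free; apply/(ES _ _ (Esum a)).
have [f' Af' Ef] := Etot _ Af; have [a Sa] := q'span _ Af'; exists a.
apply/(ES _ (fun y => f' y - \sum_(i < d) a i * q' i y)) => //.
have := EL.2 (-1) _ _ _ _ (Esum a) Ef.
by congr E; apply: funext => x; rewrite mulN1r addrC.
Qed.

End QuotDim.

(** * Invariant quasimorphisms and cup products *)

Section Correspondence.
Variables (R : realType) (G : groupType) (N : G -> Prop).
Hypotheses (nN : normal_subgroup N) (abN : quotient_abelian N).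
Hypothesis fgN : quotient_fin_gen N.
Implicit Types (psi phi u : G -> R) (b : G -> G -> R).

Definition comm_near psi b := exists C : R, forall x y, `|psi [~ x, y]%g - b x y| <= C.

Let sN := normal_subgroup_sub nN.

Lemma QNG_lin (a : R) psi phi : QNG N psi -> QNG N phi ->
  QNG N (fun x => a * psi x + phi x).
Proof.
move=> [[[D hD] hX] hJ] [[[D' hD'] hX'] hJ']; split; last first.
  by move=> g x Nx; rewrite hJ // hJ'.
split; last by move=> x z Nx; rewrite hX // hX' //; ring.
exists (`|a| * D + D') => x y Nx Ny.
rewrite (_ : _ - _ - _ = a * (psi (x * y)%g - psi x - psi y) +
  (phi (x * y)%g - phi x - phi y)); last by ring.
apply: le_trans (ler_normD _ _) _; rewrite normrM lerD ?hD' //.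
by rewrite ler_wpM2l // hD.
Qed.

Lemma QNG0 : QNG N (fun _ : G => 0 : R).
Proof.
split=> //; split=> [|x z _]; last by rewrite mulr0.
by exists 0 => x y _ _; rewrite !subr0 normr0.
Qed.

Lemma H1NG_QNG h : H1NG N h -> QNG N (h : G -> R).
Proof.
have [N1 NM NV NJ] := nN.
move=> [hM hJ]; split=> //; split.
  by exists 0 => x y Nx Ny; rewrite hM // -addrA -opprD subrr normr0.
have h1 : h 1%g = 0 by have := hM _ _ N1 N1; rewrite mulg1; lra.
move=> x z Nx; have pos (n : nat) : N (x ^+ n)%g /\ h (x ^+ n)%g = n%:R * h x.
  elim: n => [|n [Nn IH]]; first by rewrite expg0 h1 mul0r.
  by split; rewrite expgS; [exact: NM|rewrite hM // IH mulrSr; ring].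
case: z => n; first by have [_ ->] := pos n.
have [Nn e] := pos n.+1; have := hM _ _ Nn (NV _ Nn).
by rewrite mulgV h1 e NegzE mulrNz mulNr /= -pmulrn; lra.
Qed.

Lemma comm_near_lin (a : R) psi phi b b' : comm_near psi b -> comm_near phi b' ->
  comm_near (fun x => a * psi x + phi x) (fun x y => a * b x y + b' x y).
Proof.
move=> [C hC] [C' hC']; exists (`|a| * C + C') => x y.
rewrite (_ : _ - _ = a * (psi [~ x, y]%g - b x y) + (phi [~ x, y]%g - b' x y)); last by ring.
apply: le_trans (ler_normD _ _) _; rewrite normrM lerD //.
by rewrite ler_wpM2l.
Qed.

Lemma comm_near0 : comm_near (fun=> 0) (fun _ _ => 0).
Proof. by exists 0 => x y; rewrite subr0 normr0. Qed.

(** [[~ x, y]] arises by three products, each costing one defect; the values of [phi] cancel because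
    [phi] is odd. *)
Lemma qm_comm_near0 phi : homog_qm_on (fun=> True) phi -> comm_near phi (fun _ _ => 0).
Proof.
move=> [[D hD] hX]; exists (3 * D) => x y.
have phiV z : phi (z^-1)%g = - phi z.
  by have := hX z (-1) I; rewrite zpowN zpow1 mulN1r.
have /norm_le[h1 h2] := hD (x^-1)%g (x ^ y)%g I I.
have /norm_le[h3 h4] := hD (y^-1)%g (x * y)%g I I.
have /norm_le[h5 h6] := hD x y I I.
move: h1 h2 h3 h4; rewrite -commgEl -conjgE !phiV => h1 h2 h3 h4.
by rewrite subr0 ler_norml; move: h1 h2 h3 h4 h5 h6; lra.
Qed.

Lemma comm_near_uniq psi b b' : altform N b -> altform N b' ->
  comm_near psi b -> comm_near psi b' -> forall x y, b x y = b' x y.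
Proof.
move=> hb hb' [C hC] [C' hC'] x y.
have e := @altform_bounded_eq0 _ _ N _ (C + C') (altform_lin (-1) hb hb') _ x y.
suff : -1 * b x y + b' x y = 0 by lra.
apply: e => {}x {}y; have /norm_le[h1 h2] := hC x y; have /norm_le[h3 h4] := hC' x y.
by rewrite ler_norml; move: h1 h2 h3 h4; lra.
Qed.

Lemma H1NG_altform h : H1NG N h -> altform N (fun x y => h [~ x, y]%g : R).
Proof.
have [N1 NM NV NJ] := nN.
move=> [hM hJ]; have h1 : h 1%g = 0 by have := hM _ _ N1 N1; rewrite mulg1; lra.
split=> [z x y|x y z|x|n y Nn].
- by rewrite commMgE hM ?hJ //; exact: NJ.
- by rewrite commgME hM ?hJ // 1?addrC //; exact: NJ.
- by rewrite commgg.
- have Ny := NJ _ y Nn; have := hM _ _ (NV _ Nn) Nn.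
  by rewrite mulVg h1 commgEl hM ?hJ //; exact: NV.
Qed.

(** Extension with the zero form gives a quasimorphism on [G] near [psi] on [N]. After
    homogenization the two agree exactly on [N], being homogeneous and at bounded distance. *)
Lemma comm_bounded_extends psi : QNG N psi -> comm_near psi (fun _ _ => 0) ->
  exists2 phi, homog_qm_on (fun=> True) phi & forall n, N n -> psi n = phi n.
Proof.
move=> [[[D hD] hX] hJ] [C hC].
pose M := Num.max D C.
have [||K [u [hu hn]]] := @quasimorphism_extension _ _ _ nN abN _ psi (altform0 R N) M fgN.
- by move=> x y Nx Ny; apply: le_trans (hD x y Nx Ny) _; rewrite le_max lexx.
- by move=> x y; apply: le_trans (hC x y) _; rewrite le_max lexx orbT.
have {}hu x y : `|u (x * y)%g - u x - u y| <= K * M.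
  by have := hu x y; rewrite mul0r subr0.
have [//|x s t _|phi hphi] := @homogenize R G (fun=> True) u (K * M).
  by rewrite zpowD; exact: hu.
have phiu x : - (4 * (K * M)) <= phi x - u x /\ phi x - u x <= 4 * (K * M).
  by apply: norm_le; case: (hphi x I).
have phiX x t : phi (zpow x t) = t%:~R * phi x by case: (hphi x I).
exists phi.
  split; last by move=> x t _; exact: phiX.
  exists (13 * (K * M)) => x y _ _.
  have [h1 h2] := phiu x; have [h3 h4] := phiu y; have [h5 h6] := phiu (x * y)%g.
  have /norm_le[h7 h8] := hu x y.
  by rewrite ler_norml; move: h1 h2 h3 h4 h5 h6 h7 h8; lra.
apply: (@homogeneous_near_eq _ _ N psi phi (5 * (K * M))) => [x t Nx|//|//|n Nn].
  exact: subgroup_zpow.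
have [h1 h2] := phiu n; have /norm_le[h3 h4] := hn n Nn.
by rewrite ler_norml; move: h1 h2 h3 h4; lra.
Qed.

(** As [b] vanishes when an argument lies in [N], [u] is an invariant homomorphism on [N], and [u
    [~ x, y] = - 2 * b x y]. Hence [psi + u / 2] has zero form and extends to [G]. *)
Lemma coboundary_W_den psi b u : QNG N psi -> altform N b -> comm_near psi b ->
  (forall x y, b x y = d1 u (x, y)) -> W_den N psi.
Proof.
move=> Qpsi hb near_b hu; have [N1 NM NV NJ] := nN.
have uM x y : u (x * y)%g = u x + u y - b x y by rewrite hu /d1 /=; lra.
have uH : H1NG N (fun x => - (2^-1) * u x).
  split=> [x y Nx Ny|g x Nx]; first by rewrite uM (altN hb) //; ring.
  have e1 := uM x g; have e2 := uM g (x ^ g)%g.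
  rewrite -conjgC e1 (altN hb) // (altNr _ hb (NJ _ g Nx)) in e2.
  by congr (_ * _); lra.
have Qpsi' := QNG_lin (-1) (H1NG_QNG uH) Qpsi.
have near0 : comm_near (fun x => -1 * (- (2^-1) * u x) + psi x) (fun _ _ => 0).
  case: near_b => C hC; exists C => x y; have := hC x y.
  have e1 := uM x y; have e2 := uM (y * x)%g [~ x, y]%g; have e3 := uM y x.
  rewrite -commgC (altNr _ hb (abN x y)) in e2.
  congr (`|_| <= _); have := altC x y hb; lra.
have [phi Qphi hphi] := comm_bounded_extends Qpsi' near0.
exists (fun x => - (2^-1) * u x), phi; split=> //; split=> // n Nn.
by rewrite -hphi //; ring.
Qed.

(** The summand [phi] has zero form, so [b] is the form of [h], with equality because both are
    bilinear. *)
Lemma W_den_coboundary psi b : altform N b -> comm_near psi b -> W_den N psi ->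
  exists u : G -> R, forall x y, b x y = d1 u (x, y).
Proof.
move=> hb near_b [h [phi [Hh [Qphi hphi]]]].
have hbE x y : b x y = h [~ x, y]%g.
  apply: (comm_near_uniq (psi := h) hb (H1NG_altform Hh)); last first.
    by exists 0 => ? ?; rewrite subrr normr0.
  have [C hC] := comm_near_lin (-1) (qm_comm_near0 Qphi) near_b.
  exists C => z t; have := hC z t; rewrite hphi //.
  by congr (`|_| <= _); ring.
(* Applied with [D = 0], the extension satisfies [u (x * y) - u x - u y = b x y / 2] exactly, whence
   the witness [- 2 * u]. *)
have [||K [u [hu _]]] := @quasimorphism_extension _ _ _ nN abN _ h hb 0 fgN.
- by case: Hh => hM _ x y Nx Ny; rewrite hM // -addrA -opprD subrr normr0.
- by move=> x y; rewrite hbE subrr normr0.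
exists (fun x => - 2 * u x) => x y.
by have := hu x y; rewrite mulr0 normr_le0 => /eqP; rewrite /d1 /=; lra.
Qed.

(** Surjectivity of the comparison map enters here: it makes [b + d u'] bounded for some [u'], so
    [u'] is a quasimorphism on [N], where [b] vanishes. *)
Lemma altform_comm_near b : comparison2_surjective R G -> altform N b ->
  exists2 psi, QNG N psi & comm_near psi b.
Proof.
move=> surj hb; have [N1 NM NV NJ] := nN.
have cb : cocycle2 (fun p => b p.1 p.2).
  by move=> x y z /=; rewrite (altMl hb) (altMr hb); ring.
have [b0 [u [_ [[M hM] hu]]]] := surj _ cb.
have {hM}hu x y : - M <= u (x * y)%g - u x - u y + b x y /\
    u (x * y)%g - u x - u y + b x y <= M.
  have -> : u (x * y)%g - u x - u y + b x y = b0 (x, y).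
    by have := hu (x, y); rewrite /d1 /=; lra.
  exact: norm_le.
have NX x t : N x -> N (zpow x t) by exact: subgroup_zpow.
have [x s t Nx|v hv] := @homogenize R G N u M NX.
  have := hu (zpow x s) (zpow x t).
  by rewrite (altN hb) ?addr0 -?zpowD; [case=> h1 h2; rewrite ler_norml h1|exact: NX].
have vu x : N x -> - (4 * M) <= v x - u x /\ v x - u x <= 4 * M.
  by move=> Nx; apply: norm_le; case: (hv x Nx).
have vX x t : N x -> v (zpow x t) = t%:~R * v x by move=> Nx; case: (hv x Nx).
have Qv : QNG N v.
  split; first split=> //.
    exists (13 * M) => x y Nx Ny.
    have [h1 h2] := vu _ Nx; have [h3 h4] := vu _ Ny.
    have [h5 h6] := vu _ (NM _ _ Nx Ny); have [h7 h8] := hu x y.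
    move: h7 h8; rewrite (altN hb) // => h7 h8.
    by rewrite ler_norml; move: h1 h2 h3 h4 h5 h6 h7 h8; lra.
  (* Invariance comes from [x * g = g * x ^ g]: [b] vanishes on both pairs, so [u] changes by at
     most [2 * M], and homogenization adds [8 * M]. *)
  move=> g; apply: (@homogeneous_near_eq _ _ N (fun x => v (x ^ g)%g) v (10 * M)) => //.
    by move=> x t Nx; rewrite conjg_zpow vX //; exact: NJ.
  move=> x Nx; have Nxg := NJ _ g Nx.
  have [h1 h2] := vu _ Nx; have [h3 h4] := vu _ Nxg.
  have [h5 h6] := hu x g; have [h7 h8] := hu g (x ^ g)%g.
  move: h5 h6 h7 h8; rewrite -conjgC (altN hb) // (altNr _ hb Nxg) => h5 h6 h7 h8.
  by rewrite ler_norml; move: h1 h2 h3 h4 h5 h6 h7 h8; lra.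
(* From [x * y = y * x * [~ x, y]], the value [u [~ x, y]] is near [b y x - b x y = - 2 * b x y];
   the factor is removed at the end by rescaling. *)
have near_v : comm_near v (fun x y => - 2 * b x y).
  exists (7 * M) => x y; have Nxy := abN x y.
  have [h1 h2] := vu _ Nxy; have [h3 h4] := hu x y.
  have [h5 h6] := hu y x; have [h7 h8] := hu (y * x)%g [~ x, y]%g.
  move: h7 h8; rewrite -commgC (altNr _ hb Nxy) => h7 h8.
  have e := altC y x hb.
  by rewrite ler_norml; move: h1 h2 h3 h4 h5 h6 h7 h8; rewrite e; lra.
exists (fun x => - (2^-1) * v x + 0); first exact: QNG_lin Qv QNG0.
have [C hC] := comm_near_lin (- (2^-1)) near_v comm_near0.
exists C => x y; have := hC x y; congr (`|_ - _| <= _).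
by field.
Qed.

(** * Alternating forms as representatives of cup products *)

Lemma calH_vanish k (gen : 'I_k -> G) :
  (forall x, exists w, N (x * (word_eval gen w)^-1)%g) ->
  forall f : G -> R, calH N f -> (forall i, f (gen i) = 0) -> forall x, f x = 0.
Proof.
move=> hgen f [fM fN] f0 x; have [w Nw] := hgen x.
rewrite -(mulgVK (word_eval gen w) x) fM fN // add0r.
elim: w {Nw} => [|[i s] w IH] /=; first exact: hom1 fM.
by rewrite fM IH addr0; case: s => /=; rewrite ?(homV _ fM) f0 ?oppr0.
Qed.

Lemma altform_calH b x : altform N b -> calH N (b x).
Proof. by move=> hb; split=> [|n Nn]; [exact: (altMr hb)|exact: (altNr _ hb)]. Qed.

(** [calH] is finite-dimensional, its members being determined on the generators. Expanding [b x] in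
    a basis, uniqueness of the coefficients makes them homomorphisms in [x] that vanish on [N]. *)
Lemma altform_sum_cup b : altform N b ->
  exists k (f g : 'I_k -> G -> R), [/\ forall i, calH N (f i), forall i, calH N (g i)
    & forall x y, b x y = \sum_(i < k) f i x * g i y].
Proof.
move=> hb; have [k [gen hgen]] := fgN.
have [|||//|d [q [Hq [qfree qspan]]]] := @quot_dim_exists R G 'I_k (calH N)
  (fun f => forall x, f x = 0)
  (fun f v => calH N f /\ forall i, f (gen i) = v i).
- split; first by split=> //; split=> // x y; rewrite addr0.
  move=> a f g f' g' [[fM fN] ef] [[gM gN] eg]; split; last by move=> i; rewrite ef eg.
  by split=> [x y|n Nn]; [rewrite fM gM; ring|rewrite fN // gN // mulr0 addr0].
- by move=> f Hf; exists (fun i => f (gen i)).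
- by move=> f [Hf f0]; exact: (calH_vanish hgen).
- by move=> a f f0 x; rewrite f0 mulr0.
have [c hc] : {c : G -> 'I_d -> R & forall x y, b x y - \sum_(i < d) c x i * q i y = 0}.
  apply: (@choice _ _ (fun x a => forall y, b x y - \sum_(i < d) a i * q i y = 0)) => x.
  exact/qspan/altform_calH.
have {}hc x y : b x y = \sum_(i < d) c x i * q i y by apply/eqP; rewrite -subr_eq0 hc.
exists d, (fun i x => c x i), q; split=> // i; split=> [x y|n Nn].
  suff : c (x * y)%g i - c x i - c y i = 0 by lra.
  apply: (qfree (fun i => c (x * y)%g i - c x i - c y i)) => z.
  under eq_bigr do rewrite !mulrBl.
  by rewrite !sumrB -!hc (altMl hb) addrAC addrK subrr.
by apply: (qfree (c n)) => z; rewrite -hc (altN hb).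
Qed.

Lemma altform_cup_image b u : altform N b ->
  cup_image N (fun p => b p.1 p.2 + d1 u p).
Proof.
move=> /altform_sum_cup[k [f [g [Hf Hg e]]]].
by exists k, f, g, u; split=> //; split=> // p; rewrite e.
Qed.

(* The symmetric part f(x) g(y) + f(y) g(x) of a cup product is - d1 (f g). *)
Lemma cup_image_altform (c : G * G -> R) : cup_image N c ->
  exists2 b, altform N b & exists u, forall p, c p = b p.1 p.2 + d1 u p.
Proof.
move=> [k [f [g [u [Hf [Hg e]]]]]].
pose be x y : R := \sum_(i < k) f i x * g i y.
have beMl x y z : be (x * y)%g z = be x z + be y z.
  by rewrite /be -big_split; apply: eq_bigr => i _; rewrite (Hf i).1 mulrDl.
have beMr x y z : be x (y * z)%g = be x y + be x z.
  by rewrite /be -big_split; apply: eq_bigr => i _; rewrite (Hg i).1 mulrDr.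
have beNl n y : N n -> be n y = 0.
  by move=> Nn; rewrite /be big1 // => i _; rewrite (Hf i).2 // mul0r.
have beNr n y : N n -> be y n = 0.
  by move=> Nn; rewrite /be big1 // => i _; rewrite (Hg i).2 // mulr0.
exists (fun x y => (be x y - be y x) / 2).
  split=> [z x y|x y z|x|n y Nn].
  - by rewrite !beMl !beMr; ring.
  - by rewrite !beMl !beMr; ring.
  - by rewrite subrr mul0r.
  - by rewrite beNl // beNr // subrr mul0r.
exists (fun x => u x - be x x / 2) => -[x y] /=.
by rewrite e /d1 /= /cup /= -/(be x y) beMl !beMr; field.
Qed.

(** The correspondence from [psi] to the class of its form; the free [u] lets [c] run through the
    whole class. *)
Definition cup_rel psi (c : G * G -> R) : Prop :=
  QNG N psi /\ exists b u, [/\ altform N b, comm_near psi b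
    & forall p, c p = b p.1 p.2 + d1 u p].

Lemma linear_cup_rel : linear_rel cup_rel.
Proof.
split.
  split; first exact: QNG0.
  exists (fun _ _ => 0), (fun=> 0); split; [exact: altform0|exact: comm_near0|].
  by move=> p; rewrite /d1 subrr !addr0.
move=> a psi phi c c' [Q [b [u [hb nb e]]]] [Q' [b' [u' [hb' nb' e']]]].
split; first exact: QNG_lin.
exists (fun x y => a * b x y + b' x y), (fun x => a * u x + u' x).
split; [exact: altform_lin|exact: comm_near_lin|].
by move=> p; rewrite e e' /d1; ring.
Qed.

Lemma cup_rel_kernel psi c : cup_rel psi c -> (W_den N psi <-> coboundary2 c).
Proof.
move=> [Q [b [u [hb nb e]]]]; split.
  move=> /(W_den_coboundary hb nb)[u' hu']; exists (fun x => u' x + u x) => p.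
  by rewrite e hu' /d1 /=; ring.
move=> [u' hu']; apply: (@coboundary_W_den _ b (fun x => u' x - u x)) => // x y.
by have := e (x, y); rewrite hu' /d1 /=; lra.
Qed.

(** After passing to an alternating representative, the values of the form on pairs of generators
    serve as finitely many coordinates. *)
Lemma cup_image_dim : exists d, quot_dim (@cup_image R G N) (@coboundary2 R G) d.
Proof.
have [k [gen hgen]] := fgN.
apply: (@quot_dim_exists R _ ('I_k * 'I_k)%type _ _ (fun c v => exists b u,
  [/\ altform N b, forall p, c p = b p.1 p.2 + d1 u p
    & forall i, b (gen i.1) (gen i.2) = v i])).
- split.
    exists (fun _ _ => 0), (fun=> 0); split=> //; first exact: altform0.
    by move=> p; rewrite /d1 subrr !addr0.
  move=> a c c' v v' [b [u [hb e ev]]] [b' [u' [hb' e' ev']]].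
  exists (fun x y => a * b x y + b' x y), (fun x => a * u x + u' x).
  split=> [|p|i]; first exact: altform_lin.
    by rewrite e e' /d1; ring.
  by rewrite ev ev'.
- move=> c /cup_image_altform[b hb [u e]].
  by exists (fun i => b (gen i.1) (gen i.2)), b, u.
- move=> c [b [u [hb e ev]]]; exists u => p.
  suff -> : c p = 0 + d1 u p by rewrite add0r.
  rewrite e; congr (_ + _); apply: (calH_vanish hgen (altform_calH _ hb)) => i.
  rewrite (altC _ _ hb) (calH_vanish hgen (altform_calH _ hb)) ?oppr0 // => j.
  exact: (ev (i, j)).
- move=> a c [u e]; exists (fun x => a * u x) => p.
  by rewrite e /d1; ring.
Qed.

End Correspondence.

(** * Equality of the two dimensions *)

Theorem theorem11p6 (R : realType) (G : groupType) (N : G -> Prop) :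
  normal_subgroup N ->
  quotient_abelian N ->
  quotient_fin_gen N ->
  @comparison2_surjective R G ->
  exists d : nat,
    quot_dim (@QNG R G N) (@W_den R G N) d /\
    quot_dim (@cup_image R G N) (@coboundary2 R G) d.
Proof.
(* The dimension is found on the cup product side, then carried to [W(G, N)] along [cup_rel]. *)
move=> nN abN fgN surj; have [d hd] := cup_image_dim R fgN.
exists d; split=> //; apply: (quot_dim_transport (E := cup_rel N)) hd.
- exact: linear_cup_rel.
- move=> psi Q; have [b hb nb] := QNG_altform nN abN Q.
  exists (fun p => b p.1 p.2 + d1 (fun=> 0) p); first exact: altform_cup_image.
  by split=> //; exists b, (fun=> 0).
- move=> c /cup_image_altform[b hb [u e]].
  have [psi Q nb] := altform_comm_near nN abN surj hb.
  by exists psi => //; split=> //; exists b, u.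
- by move=> psi c; exact: cup_rel_kernel.
Qed.
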